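(* $\bigl(\check{\mathcal C}(\mathbb R^n),\check h\bigr)$ is a complete metric space.
   Context: $\mathbb R^n$ carries the Euclidean distance $d$. For nonempty $A,B\subseteq\mathbb R^n$, with $d(x,A)=d(A,x)=\inf\{d(x,a):a\in A\}$, the Hausdorff distance is $h(A,B)=\max\{\sup_{a\in A}d(a,B),\ \sup_{b\in B}d(A,b)\}$. An isometry $\psi$ of $\mathbb R^n$ is rigid if $\psi=\sigma\circ\tau$ with $\tau$ a translation and $\sigma$ an orthogonal transformation with $\det\sigma=1$; $\overline h(A,B)=\inf\{h(\varphi(A),\psi(B)):\varphi,\psi\text{ rigid isometries of }\mathbb R^n\}$. A rigid $r$-similitude ($r>0$) is a map $S=\mu_r\circ\sigma\circ\tau$ where $\mu_r(x)=rx$, $\sigma$ is an orthogonal transformation with $\det\sigma=1$ and $\tau$ is a translation. Nonempty sets $A,B$ are rigidly similar if $B=S(A)$ for some rigid similitude $S$; this is an equivalence relation and the class of $A$ is $\check A$. The radius of $A$ is $\mathrm r(A)=\inf_{x\in\mathbb R^n}\sup_{a\in A}d(x,a)$. For $\rho\ge0$, $\rho A=\{\rho a:a\in A\}$, and $\frac{A}{\mathrm r(A)}=\frac1{\mathrm r(A)}A$, with the convention that $\frac{A}{\mathrm r(A)}$ means $A$ when $A$ is a singleton. For nonempty bounded $A,B$ the relative rigid shape difference is $\check h(A,B)=\overline h\bigl(\frac A{\mathrm r(A)},\frac B{\mathrm r(B)}\bigr)$; it depends only on the rigid similarity classes and one sets $\check h(\check A,\check B):=\check h(A,B)$. $\mathcal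 C(\mathbb R^n)$ is the set of nonempty compact subsets of $\mathbb R^n$, and $\check{\mathcal C}(\mathbb R^n)=\{\check C: C\in\mathcal C(\mathbb R^n)\}$. *)

(* Defs.v *)
From mathcomp Require Import all_boot all_order all_algebra.
From mathcomp Require Import all_classical all_reals all_analysis.

Set Implicit Arguments.
Unset Strict Implicit.
Unset Printing Implicit Defensive.

Import Order.TTheory GRing.Theory Num.Theory.
Import numFieldNormedType.Exports.

Local Open Scope classical_set_scope.
Local Open Scope ring_scope.

(* MathComp's norm on 'rV[R]_n is the sup norm, so the Euclidean distance is
   written out. Both induce the same topology, so the library's [compact] is
   compactness in Euclidean space. *)
Definition edistance (R : realType) (n : nat) (x y : 'rV[R]_n) : R :=
  Num.sqrt (\sum_(i < n) (x 0 i - y 0 i) ^+ 2).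

Definition dist_set (R : realType) (n : nat) (x : 'rV[R]_n)
    (A : set 'rV[R]_n) : R :=
  inf [set edistance x a | a in A].

(* The suprema in [hausdorff_dist] and [radius] are real-valued, hence
   meaningful for nonempty bounded sets only; on other sets they may take the
   default value 0 of [sup]. *)
Definition hausdorff_dist (R : realType) (n : nat) (A B : set 'rV[R]_n) : R :=
  Num.max (sup [set dist_set a B | a in A]) (sup [set dist_set b A | b in B]).

Definition is_translation (R : realType) (n : nat)
    (tau : 'rV[R]_n -> 'rV[R]_n) : Prop :=
  exists b : 'rV[R]_n, forall x, tau x = x + b.

Definition is_rotation (R : realType) (n : nat)
    (sigma : 'rV[R]_n -> 'rV[R]_n) : Prop :=
  exists P : 'M[R]_n,
    [/\ P *m P^T = 1%:M, \det P = 1 & forall x, sigma x = x *m P].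

Definition rigid_isometry (R : realType) (n : nat)
    (psi : 'rV[R]_n -> 'rV[R]_n) : Prop :=
  exists sigma tau : 'rV[R]_n -> 'rV[R]_n,
    [/\ is_rotation sigma, is_translation tau & psi = sigma \o tau].

Definition rigid_hausdorff_dist (R : realType) (n : nat)
    (A B : set 'rV[R]_n) : R :=
  inf [set t | exists phi psi : 'rV[R]_n -> 'rV[R]_n,
    [/\ rigid_isometry phi, rigid_isometry psi
      & t = hausdorff_dist (phi @` A) (psi @` B)]].

Definition rigid_similitude (R : realType) (n : nat) (r : R)
    (S : 'rV[R]_n -> 'rV[R]_n) : Prop :=
  exists sigma tau : 'rV[R]_n -> 'rV[R]_n,
    [/\ is_rotation sigma, is_translation tau
      & S = (fun x => r *: x) \o sigma \o tau].

Definition rigidly_similar (R : realType) (n : nat)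
    (A B : set 'rV[R]_n) : Prop :=
  exists (r : R) (S : 'rV[R]_n -> 'rV[R]_n),
    [/\ 0 < r, rigid_similitude r S & B = S @` A].

Definition similarity_class (R : realType) (n : nat) (A : set 'rV[R]_n) :
    set (set 'rV[R]_n) :=
  [set B | rigidly_similar A B].

Definition radius (R : realType) (n : nat) (A : set 'rV[R]_n) : R :=
  inf [set sup [set edistance x a | a in A] | x in [set: 'rV[R]_n]].

Definition scale_set (R : realType) (n : nat) (rho : R) (A : set 'rV[R]_n) :
    set 'rV[R]_n :=
  [set rho *: a | a in A].

Definition normalize_set (R : realType) (n : nat) (A : set 'rV[R]_n) :
    set 'rV[R]_n :=
  if `[< exists x, A = [set x] >] then A else scale_set (radius A)^-1 A.

Definition shape_diff (R : realType) (n : nat) (A B : set 'rV[R]_n) : R :=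
  rigid_hausdorff_dist (normalize_set A) (normalize_set B).

Definition nonempty_compacts (R : realType) (n : nat) : set (set 'rV[R]_n) :=
  [set A | A !=set0 /\ compact A].
Arguments nonempty_compacts : clear implicits.

Definition compact_shapes (R : realType) (n : nat) :
    set (set (set 'rV[R]_n)) :=
  [set similarity_class C | C in nonempty_compacts R n].
Arguments compact_shapes : clear implicits.

Definition class_repr (R : realType) (n : nat) (X : set (set 'rV[R]_n)) :
    set 'rV[R]_n :=
  xget set0 [set C | nonempty_compacts R n C /\ similarity_class C = X].

(* Evaluated on chosen representatives; that the value does not depend on the
   choice has to be proved, see [represents_shape_diff]. *)
Definition class_shape_diff (R : realType) (n : nat)
    (X Y : set (set 'rV[R]_n)) : R :=
  shape_diff (class_repr X) (class_repr Y).

Definition represents_shape_diff (R : realType) (n : nat)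
    (d : set (set 'rV[R]_n) -> set (set 'rV[R]_n) -> R) : Prop :=
  forall A B : set 'rV[R]_n,
    nonempty_compacts R n A -> nonempty_compacts R n B ->
    d (similarity_class A) (similarity_class B) = shape_diff A B.

Definition is_metric_on (R : realType) (T : Type) (M : set T)
    (d : T -> T -> R) : Prop :=
  [/\ forall x y, M x -> M y -> 0 <= d x y,
      forall x y, M x -> M y -> (d x y = 0 <-> x = y),
      forall x y, M x -> M y -> d x y = d y x
    & forall x y z, M x -> M y -> M z -> d x z <= d x y + d y z].

Definition is_complete_on (R : realType) (T : Type) (M : set T)
    (d : T -> T -> R) : Prop :=
  forall u : nat -> T, (forall k, M (u k)) ->
    (forall e : R, 0 < e -> exists N : nat, forall i j : nat,
       (N <= i)%N -> (N <= j)%N -> d (u i) (u j) < e) ->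
    exists2 l : T, M l & forall e : R, 0 < e -> exists N : nat,
      forall i : nat, (N <= i)%N -> d (u i) l < e.

(* Main.v *)
From mathcomp Require Import all_boot all_order all_algebra.
From mathcomp Require Import all_classical all_reals all_analysis.
From mathcomp Require Import ring lra.
Require Import Defs.

Set Implicit Arguments.
Unset Strict Implicit.
Unset Printing Implicit Defensive.

Import Order.TTheory GRing.Theory Num.Theory.
Import numFieldNormedType.Exports.

Local Open Scope classical_set_scope.
Local Open Scope ring_scope.

(** Up to rigid isometries, the shape difference is a Hausdorff distance between
    normalized sets, so the work is to show that the Hausdorff distance modulo
    rigid motions is a complete metric on congruence classes and that
    normalization turns similarity into congruence.

    The Hausdorff distance is handled through the relation [mutually_close e]:
    each point of either set is within [e] of the other set. The two agree up
    to an arbitrarily small loss, and the relation can be composed and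
    transported by isometries, which gives the triangle inequality and the
    symmetry of [rigid_hausdorff_dist] once one of the two motions in its
    definition has been absorbed ([rigid_hausdorff_dist_lt],
    [rigid_hausdorff_dist_le]).

    If the distance of two compact sets vanishes, there are rigid motions
    bringing one within [1/(k+1)] of the other. Their rotation matrices have
    entries bounded by 1 and their translation parts are bounded because the
    sets are, so along a free ultrafilter on the integers they converge to a
    rigid motion, which carries one set onto the other
    ([ultra_rigid_isometry_limit], [rigid_hausdorff_dist_eq0]).

    A normalized set has radius 0 or 1, and the radius scales with the factor of
    a similitude. Hence a similitude between normalized sets is an isometry,
    except between two points, where a translation does the same job
    ([rigidly_similar_normalizeP]). Thus the value on classes is well defined
    and vanishes exactly on equal classes.

    For completeness, a Cauchy sequence is thinned out so that consecutive
    distances are below [2^-j], and each set is moved next to its already moved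
    predecessor. The moved sets are Cauchy for the Hausdorff distance and
    converge to an explicit compact set ([geometric_hausdorff_limit]). The radius
    is 1-Lipschitz for the distance, so the limit again has radius 0 or 1, is its
    own normalization, and its class is the limit in the space of shapes. *)

(** * Euclidean distance *)

(** After squaring, this is the Cauchy-Schwarz inequality. *)
Lemma minkowski2 (R : rcfType) (n : nat) (x y : 'I_n -> R) :
  Num.sqrt (\sum_i (x i + y i) ^+ 2) <=
  Num.sqrt (\sum_i x i ^+ 2) + Num.sqrt (\sum_i y i ^+ 2).
Proof.
set a := Num.sqrt (\sum_i x i ^+ 2); set b := Num.sqrt (\sum_i y i ^+ 2).
have X0 : 0 <= \sum_i x i ^+ 2 by apply: sumr_ge0 => i _; exact: sqr_ge0.
have Y0 : 0 <= \sum_i y i ^+ 2 by apply: sumr_ge0 => i _; exact: sqr_ge0.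
have aE : a ^+ 2 = \sum_i x i ^+ 2 by rewrite sqr_sqrtr.
have bE : b ^+ 2 = \sum_i y i ^+ 2 by rewrite sqr_sqrtr.
have a0 : 0 <= a by exact: sqrtr_ge0.
have b0 : 0 <= b by exact: sqrtr_ge0.
have -> : a + b = Num.sqrt ((a + b) ^+ 2).
  by rewrite sqrtr_sqr ger0_norm ?addr_ge0.
rewrite ler_sqrt ?sqr_ge0//.
have zero (z : 'I_n -> R) : \sum_i z i ^+ 2 = 0 -> forall i, z i = 0.
  move=> /eqP; rewrite psumr_eq0 => [/allP z0 i|i _]; last exact: sqr_ge0.
  by apply/eqP; rewrite -sqrf_eq0; apply: z0; rewrite mem_index_enum.
have [a_eq0|a_neq0] := eqVneq a 0.
  have /zero x0 : \sum_i x i ^+ 2 = 0 by rewrite -aE a_eq0 expr0n.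
  by rewrite a_eq0 add0r bE; apply: ler_sum => i _; rewrite x0 add0r.
have [b_eq0|b_neq0] := eqVneq b 0.
  have /zero y0 : \sum_i y i ^+ 2 = 0 by rewrite -bE b_eq0 expr0n.
  by rewrite b_eq0 addr0 aE; apply: ler_sum => i _; rewrite y0 addr0.
have ab_gt0 : 0 < a * b by rewrite mulr_gt0 ?lt_def ?a_neq0 ?b_neq0.
(* the coefficients equalise the lengths, so that the square is a b times
   twice the Cauchy-Schwarz defect *)
have : 0 <= \sum_i (b * x i - a * y i) ^+ 2.
  by apply: sumr_ge0 => i _; exact: sqr_ge0.
rewrite (eq_bigr (fun i => b ^+ 2 * x i ^+ 2 + a ^+ 2 * y i ^+ 2
     - (2 * (a * b)) * (x i * y i))) => [|i _]; last by ring.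
rewrite sumrB big_split /= -!mulr_sumr -aE -bE.
set s := \sum_i x i * y i => h.
have sab : s <= a * b.
  rewrite -(ler_pM2l ab_gt0); lra.
rewrite (eq_bigr (fun i => x i ^+ 2 + y i ^+ 2 + 2 * (x i * y i))) => [|i _];
  last by ring.
by rewrite !big_split /= -mulr_sumr -aE -bE -/s; lra.
Qed.

Lemma edistance_ge0 (R : realType) (n : nat) (x y : 'rV[R]_n) :
  0 <= edistance x y.
Proof. exact: sqrtr_ge0. Qed.

Lemma edistancexx (R : realType) (n : nat) (x : 'rV[R]_n) : edistance x x = 0.
Proof.
by rewrite /edistance big1 ?sqrtr0// => i _; rewrite subrr expr0n.
Qed.

Lemma edistanceC (R : realType) (n : nat) (x y : 'rV[R]_n) :
  edistance x y = edistance y x.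
Proof.
by congr Num.sqrt; apply: eq_bigr => i _; rewrite -sqrrN opprB.
Qed.

Lemma edistance_triangle (R : realType) (n : nat) (y x z : 'rV[R]_n) :
  edistance x z <= edistance x y + edistance y z.
Proof.
have := minkowski2 (fun i => x 0 i - y 0 i) (fun i => y 0 i - z 0 i).
rewrite /edistance (_ : \sum_i _ = \sum_i (x 0 i - z 0 i) ^+ 2)//.
by apply: eq_bigr => i _; congr (_ ^+ _); ring.
Qed.

Lemma coord_le_edistance (R : realType) (n : nat) (x y : 'rV[R]_n) i :
  `|x 0 i - y 0 i| <= edistance x y.
Proof.
rewrite -sqrtr_sqr ler_sqrt; last by apply: sumr_ge0 => j _; exact: sqr_ge0.
by rewrite (bigD1 i)//= lerDl; apply: sumr_ge0 => j _; exact: sqr_ge0.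
Qed.

Lemma edistance_eq0 (R : realType) (n : nat) (x y : 'rV[R]_n) :
  edistance x y <= 0 -> x = y.
Proof.
move=> xy0; apply/rowP => i; apply/eqP; rewrite -subr_eq0 -normr_le0.
exact: le_trans (coord_le_edistance x y i) xy0.
Qed.

Lemma edistance_le_coord (R : realType) (n : nat) (x y : 'rV[R]_n) (e : R) :
  0 <= e -> (forall i, `|x 0 i - y 0 i| <= e) ->
  edistance x y <= Num.sqrt (n%:R) * e.
Proof.
move=> e0 xye; have -> : Num.sqrt n%:R * e = Num.sqrt (\sum_(i < n) e ^+ 2).
  rewrite sumr_const card_ord -[in RHS]mulr_natl sqrtrM ?ler0n//.
  by rewrite sqrtr_sqr ger0_norm.
rewrite ler_sqrt; last by apply: sumr_ge0 => j _; exact: sqr_ge0.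
apply: ler_sum => i _; rewrite -real_normK ?num_real//.
by rewrite lerXn2r ?nnegrE.
Qed.

(** * Compactness in terms of the Euclidean distance *)

Definition ebounded (R : realType) (n : nat) (A : set 'rV[R]_n) : Prop :=
  exists M, forall a, A a -> edistance 0 a <= M.

Definition eclosed (R : realType) (n : nat) (A : set 'rV[R]_n) : Prop :=
  forall x, (forall e, 0 < e -> exists2 a, A a & edistance x a <= e) -> A x.

(** The topology on row vectors is that of the sup norm; this and
    [coord_le_edistance] translate between sup norm and Euclidean balls. *)
Lemma exists_edistance_le_coord (R : realType) (n : nat) (e : R) : 0 < e ->
  exists2 d : R, 0 < d & forall x y : 'rV[R]_n,
    (forall i, `|x 0 i - y 0 i| <= d) -> edistance x y <= e.
Proof.
move=> e0; pose c : R := Num.sqrt n%:R + 1.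
have c0 : 0 < c by rewrite ltr_wpDl ?sqrtr_ge0.
exists (e / c) => [|x y xy]; first by rewrite divr_gt0.
apply: le_trans (edistance_le_coord _ xy) _; first by rewrite divr_ge0 ?ltW.
rewrite mulrCA ger_pMr// ler_pdivrMr// mul1r /c lerDl//.
Qed.

(** Heine-Borel, in a form that isometries and Euclidean estimates can use
    directly. *)
Lemma compact_edistanceP (R : realType) (n : nat) (A : set 'rV[R]_n) :
  compact A <-> ebounded A /\ eclosed A.
Proof.
split=> [cA|[[M AM] Acl]].
  split.
    have [M [_ /(_ (M + 1))]] := compact_bounded cA.
    rewrite ltrDl ltr01 => /(_ isT) AM.
    exists (Num.sqrt n%:R * `|M + 1|) => a /AM /= aM.
    apply: edistance_le_coord => // i; rewrite mxE sub0r normrN.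
    apply: le_trans (ler_norm _); apply: le_trans aM.
    rewrite [leRHS]/Num.norm /= mx_normrE.
    exact: (le_bigmax _ (fun ij => `|a ij.1 ij.2|) (0, i)).
  move=> x xA; apply: (compact_closed (@norm_hausdorff _ _) cA) => U.
  rewrite -nbhs_ballE => -[e /= e0 eU].
  (* halved, since balls are open *)
  have e2 : 0 < e / 2 by lra.
  have [a Aa xa] := xA _ e2.
  exists a; split => //; apply: eU; split => // i j; rewrite ord1 /ball /=.
  apply: le_lt_trans (coord_le_edistance x a j) _.
  by apply: le_lt_trans xa _; lra.
apply: bounded_closed_compact.
  exists (`|M|); split; first exact: num_real.
  move=> N MN a Aa /=; rewrite [leLHS]/Num.norm /= mx_normrE.
  apply: bigmax_le => [|[i j] _ /=].
    by apply: le_trans (ltW MN); exact: normr_ge0.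
  rewrite ord1; apply: le_trans (ltW MN); apply: le_trans (ler_norm _).
  have := coord_le_edistance 0 a j; rewrite mxE sub0r normrN => /le_trans; apply.
  exact: AM.
move=> x xA; apply: Acl => e e0.
have [d d0 dP] := exists_edistance_le_coord n e0.
have [a [Aa [_ xa]]] := xA _ (nbhsx_ballx x d d0).
by exists a => //; apply: dP => i; exact: ltW (xa 0 i).
Qed.

(** * Limits of bounded sequences along an ultrafilter *)

(** A bounded sequence lives in a compact interval, and for an ultrafilter a
    cluster point is a limit. All coordinates of a bounded family then converge
    along the same ultrafilter, which spares the extraction of subsequences. *)
Lemma ultra_bounded_cvg (R : realType) (T : Type) (F : set_system T)
    (FU : UltraFilter F) (u : T -> R) (M : R) :
  (forall t, `|u t| <= M) -> exists l : R, u @ F --> l.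
Proof.
move=> uM; have PF := @ultra_proper _ _ FU.
have FM : (u @ F) `[- M, M]%classic.
  apply: (@filterS _ F _ setT) filterT => t _ /=.
  by rewrite in_itv /= -ler_norml.
have [l [_ Fl]] := @segment_compact R (- M) M (u @ F) _ FM.
exists l => V lV; have [//|FV] := in_ultra_setVsetC (u @^-1` V) FU.
have [y [/= nVy Vy]] := Fl (~` V) V FV lV.
by [].
Qed.

Lemma near_edistance_le (R : realType) (n : nat) (T : Type) (F : set_system T)
    (FF : Filter F) (u : T -> 'rV[R]_n) (l : 'rV[R]_n) (e : R) : 0 < e ->
  (forall i, (fun t => u t 0 i) @ F --> l 0 i) ->
  \forall t \near F, edistance (u t) l <= e.
Proof.
move=> e0 ul; have [d d0 dP] := exists_edistance_le_coord n e0.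
have : \forall t \near F, forall i, `|l 0 i - u t 0 i| < d.
  by apply: filter_forall => i; exact: cvgr_dist_lt (ul i) _ d0.
by apply: filterS => t ud; apply: dP => i; rewrite distrC ltW.
Qed.

(** * Hausdorff distance as mutual closeness *)

Definition mutually_close (R : realType) (n : nat) (e : R)
    (A B : set 'rV[R]_n) : Prop :=
  (forall a, A a -> exists2 b, B b & edistance a b <= e) /\
  (forall b, B b -> exists2 a, A a & edistance a b <= e).

Lemma mutually_close_sym (R : realType) (n : nat) (e : R)
    (A B : set 'rV[R]_n) : mutually_close e A B -> mutually_close e B A.
Proof.
by move=> [AB BA]; split=> [b /BA [a Aa]|a /AB [b Bb]];
  rewrite edistanceC; [exists a|exists b].
Qed.

Lemma mutually_close_trans (R : realType) (n : nat) (e f : R)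
    (B A C : set 'rV[R]_n) :
  mutually_close e A B -> mutually_close f B C -> mutually_close (e + f) A C.
Proof.
move=> [AB BA] [BC CB]; split=> [a /AB [b /BC [c Cc bc] ab]|
                                 c /CB [b /BA [a Aa ab] bc]].
  by exists c => //; apply: le_trans (edistance_triangle b a c) (lerD ab bc).
by exists a => //; apply: le_trans (edistance_triangle b a c) (lerD ab bc).
Qed.

Lemma mutually_close_le (R : realType) (n : nat) (e f : R)
    (A B : set 'rV[R]_n) :
  e <= f -> mutually_close e A B -> mutually_close f A B.
Proof.
move=> ef [AB BA]; split=> [a /AB [b Bb ab]|b /BA [a Aa ab]].
  by exists b => //; exact: le_trans ab ef.
by exists a => //; exact: le_trans ab ef.
Qed.

Lemma dist_set_lbound (R : realType) (n : nat) (x : 'rV[R]_n)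
    (A : set 'rV[R]_n) : has_lbound [set edistance x a | a in A].
Proof. by exists 0 => _ [a _ <-]; exact: edistance_ge0. Qed.

Lemma dist_set_le (R : realType) (n : nat) (x a : 'rV[R]_n)
    (A : set 'rV[R]_n) : A a -> dist_set x A <= edistance x a.
Proof. by move=> Aa; apply: (ge_inf (dist_set_lbound x A)); exists a. Qed.

(** With [hausdorff_dist_lt], this trades suprema of infima for a relation; as
    one direction starts from a strict inequality, no infimum has to be
    attained. *)
Lemma hausdorff_dist_le (R : realType) (n : nat) (e : R)
    (A B : set 'rV[R]_n) : A !=set0 -> B !=set0 ->
  mutually_close e A B -> hausdorff_dist A B <= e.
Proof.
move=> [a0 Aa0] [b0 Bb0] [AB BA]; rewrite /hausdorff_dist ge_max.
apply/andP; split; apply: ge_sup.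
- by exists (dist_set a0 B); exists a0.
- move=> _ [a /AB [b Bb ab] <-]; exact: le_trans (dist_set_le a Bb) ab.
- by exists (dist_set b0 A); exists b0.
move=> _ [b /BA [a Aa ab] <-]; rewrite edistanceC in ab.
exact: le_trans (dist_set_le b Aa) ab.
Qed.

Lemma dist_set_ubound (R : realType) (n : nat) (A B : set 'rV[R]_n) :
  ebounded A -> B !=set0 -> has_ubound [set dist_set a B | a in A].
Proof.
move=> [M AM] [b Bb]; exists (M + edistance 0 b) => _ [a Aa <-].
apply: le_trans (dist_set_le a Bb) _.
apply: le_trans (edistance_triangle 0 a b) _.
by rewrite edistanceC lerD2r AM.
Qed.

(** Boundedness matters here: the supremum of an unbounded set is 0. *)
Lemma hausdorff_dist_lt (R : realType) (n : nat) (e : R)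
    (A B : set 'rV[R]_n) : ebounded A -> ebounded B ->
  A !=set0 -> B !=set0 ->
  hausdorff_dist A B < e -> mutually_close e A B.
Proof.
move=> bA bB A0 B0; rewrite /hausdorff_dist gt_max => /andP[ABe BAe].
split=> [a Aa|b Bb].
  have : dist_set a B < e.
    apply: le_lt_trans ABe; apply: (ub_le_sup (dist_set_ubound bA B0)).
    by exists a.
  move=> /inf_lt [|_ [b Bb <-] abe]; last by exists b => //; exact: ltW.
  by case: B0 => b Bb; exists (edistance a b); exists b.
have : dist_set b A < e.
  apply: le_lt_trans BAe; apply: (ub_le_sup (dist_set_ubound bB A0)).
  by exists b.
move=> /inf_lt [|_ [a Aa <-] abe].
  by case: A0 => a Aa; exists (edistance b a); exists a.
by exists a => //; rewrite edistanceC; exact: ltW.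
Qed.

Lemma mutually_close_ge0 (R : realType) (n : nat) (e : R)
    (A B : set 'rV[R]_n) : A !=set0 -> mutually_close e A B -> 0 <= e.
Proof.
by move=> [a Aa] [/(_ a Aa)[b _ ab] _]; exact: le_trans (edistance_ge0 a b) ab.
Qed.

Lemma hausdorff_dist_ge0 (R : realType) (n : nat) (A B : set 'rV[R]_n) :
  ebounded A -> ebounded B -> A !=set0 -> B !=set0 -> 0 <= hausdorff_dist A B.
Proof.
move=> bA bB A0 B0; rewrite leNgt; apply/negP => h0.
have := @hausdorff_dist_lt _ _ (hausdorff_dist A B / 2) _ _ bA bB A0 B0.
have hlt : hausdorff_dist A B < hausdorff_dist A B / 2 by lra.
by move=> /(_ hlt) /(mutually_close_ge0 A0); lra.
Qed.

(** * The group of rigid similitudes *)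

(** All compositions of similitudes are computed in this affine normal form. *)
Lemma rigid_similitudeP (R : realType) (n : nat) (r : R)
    (f : 'rV[R]_n -> 'rV[R]_n) : 0 < r ->
  rigid_similitude r f <-> exists (P : 'M[R]_n) (c : 'rV[R]_n),
    [/\ P *m P^T = 1%:M, \det P = 1 & f = fun x => r *: (x *m P) + c].
Proof.
move=> r0; split.
  move=> [s [t [[P [PP dP sP]] [b tb] ->]]]; exists P, (r *: (b *m P)).
  by split=> //; apply/funext => x /=; rewrite sP tb mulmxDl scalerDr.
move=> [P [c [PP dP ->]]].
exists (fun x => x *m P), (fun x => x + r^-1 *: (c *m P^T)); split.
- by exists P.
- by exists (r^-1 *: (c *m P^T)).
apply/funext => x /=; rewrite mulmxDl scalerDr; congr (_ + _).
rewrite -scalemxAl scalerA divff ?gt_eqF// scale1r.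
by rewrite -mulmxA (mulmx1C PP) mulmx1.
Qed.

Lemma rigid_isometryE (R : realType) (n : nat) (f : 'rV[R]_n -> 'rV[R]_n) :
  rigid_isometry f <-> rigid_similitude 1 f.
Proof.
by split=> -[s [t [hs ht ->]]]; exists s, t; split=> //;
  apply/funext => x /=; rewrite scale1r.
Qed.

(** The squared distance is the product of the difference with its transpose,
    in which the rotation matrix cancels. *)
Lemma rigid_similitude_edistance (R : realType) (n : nat) (r : R)
    (f : 'rV[R]_n -> 'rV[R]_n) (x y : 'rV[R]_n) : 0 < r ->
  rigid_similitude r f -> edistance (f x) (f y) = r * edistance x y.
Proof.
move=> r0 /(rigid_similitudeP _ r0) [P [c [PP _ ->]]].
pose v := x - y.
have dE (u w : 'rV[R]_n) :
    edistance u w = Num.sqrt (((u - w) *m (u - w)^T) 0 0).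
  by congr Num.sqrt; rewrite mxE; apply: eq_bigr => i _; rewrite !mxE expr2.
rewrite !dE opprD addrACA subrr addr0 -scalerBr -mulmxBl -/v.
rewrite linearZ /= -scalemxAl -scalemxAr scalerA trmx_mul mulmxA.
rewrite -(mulmxA v) PP mulmx1 mxE sqrtrM ?mulr_ge0 ?ltW//.
by rewrite -expr2 sqrtr_sqr gtr0_norm.
Qed.

Lemma rigid_similitude_scale (R : realType) (n : nat) (r : R) : 0 < r ->
  rigid_similitude r (fun x : 'rV[R]_n => r *: x).
Proof.
move=> r0; apply/(rigid_similitudeP _ r0); exists 1%:M, 0.
split; [by rewrite trmx1 mulmx1|exact: det1|].
by apply/funext => x; rewrite mulmx1 addr0.
Qed.

Lemma rigid_similitude_translation (R : realType) (n : nat) (c : 'rV[R]_n) :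
  rigid_similitude 1 (fun x : 'rV[R]_n => x + c).
Proof.
apply/(rigid_similitudeP _ ltr01); exists 1%:M, c.
split; [by rewrite trmx1 mulmx1|exact: det1|].
by apply/funext => x; rewrite mulmx1 scale1r.
Qed.

Lemma rigid_similitude_id (R : realType) (n : nat) :
  rigid_similitude 1 (@id 'rV[R]_n).
Proof.
have := rigid_similitude_translation (0 : 'rV[R]_n).
by under eq_fun => x do rewrite addr0.
Qed.

Lemma rigid_similitude_comp (R : realType) (n : nat) (r s : R)
    (f g : 'rV[R]_n -> 'rV[R]_n) : 0 < r -> 0 < s ->
  rigid_similitude r f -> rigid_similitude s g ->
  rigid_similitude (r * s) (f \o g).
Proof.
move=> r0 s0 /(rigid_similitudeP _ r0) [P [c [PP dP ->]]].
move=> /(rigid_similitudeP _ s0) [Q [d [QQ dQ ->]]].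
apply/(rigid_similitudeP _ (mulr_gt0 r0 s0)).
exists (Q *m P), (r *: (d *m P) + c); split.
- by rewrite trmx_mul mulmxA -(mulmxA Q) PP mulmx1.
- by rewrite det_mulmx dP dQ mulr1.
apply/funext => x /=.
by rewrite mulmxDl scalerDr -scalemxAl scalerA mulmxA addrA.
Qed.

Lemma rigid_similitude_inv (R : realType) (n : nat) (r : R)
    (f : 'rV[R]_n -> 'rV[R]_n) : 0 < r -> rigid_similitude r f ->
  exists g, [/\ rigid_similitude r^-1 g, cancel f g & cancel g f].
Proof.
move=> r0 /(rigid_similitudeP _ r0) [P [c [PP dP ->]]].
have rn0 : r != 0 by rewrite gt_eqF.
have ri0 : 0 < r^-1 by rewrite invr_gt0.
have PP' := mulmx1C PP.
exists (fun x => r^-1 *: (x *m P^T) + - (r^-1 *: (c *m P^T))); split.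
- apply/(rigid_similitudeP _ ri0); exists P^T, (- (r^-1 *: (c *m P^T))).
  by rewrite trmxK det_tr.
- move=> x /=; rewrite mulmxDl scalerDr addrK -scalemxAl scalerA mulVf//.
  by rewrite scale1r -mulmxA PP mulmx1.
move=> x /=; rewrite -scalerBr -mulmxBl -scalemxAl scalerA divff// scale1r.
by rewrite -mulmxA PP' mulmx1 subrK.
Qed.

Lemma mutually_close_image (R : realType) (n : nat) (e : R)
    (f : 'rV[R]_n -> 'rV[R]_n) (A B : set 'rV[R]_n) :
  rigid_similitude 1 f -> mutually_close e A B ->
  mutually_close e (f @` A) (f @` B).
Proof.
move=> rf [AB BA]; have fd x y := rigid_similitude_edistance x y ltr01 rf.
split=> [_ [a /AB [b Bb ab] <-]|_ [b /BA [a Aa ab] <-]].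
  by exists (f b); [exists b|rewrite fd mul1r].
by exists (f a); [exists a|rewrite fd mul1r].
Qed.

Lemma image_cancel (T U : Type) (f : T -> U) (g : U -> T) (A : set T) :
  cancel f g -> g @` (f @` A) = A.
Proof.
by move=> fK; rewrite image_comp (_ : g \o f = id) ?image_id//;
  apply/funext => x /=; rewrite fK.
Qed.

Lemma nonempty_compacts_image (R : realType) (n : nat) (r : R)
    (f : 'rV[R]_n -> 'rV[R]_n) (A : set 'rV[R]_n) : 0 < r ->
  rigid_similitude r f -> nonempty_compacts R n A ->
  nonempty_compacts R n (f @` A).
Proof.
move=> r0 rf [[a0 Aa0] /compact_edistanceP [[M AM] Acl]].
have fd x y := rigid_similitude_edistance x y r0 rf.
split; first by exists (f a0); exists a0.
apply/compact_edistanceP; split.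
  exists (edistance 0 (f 0) + r * M) => _ [a Aa <-].
  apply: le_trans (edistance_triangle (f 0) _ _) _.
  by rewrite lerD2l fd ler_pM2l// AM.
move=> y yA; have [g [_ fK gK]] := rigid_similitude_inv r0 rf.
exists (g y) => //; apply: Acl => e e0.
have [_ [a Aa <-]] := yA _ (mulr_gt0 r0 e0).
by rewrite -{1}(gK y) fd ler_pM2l// => ya; exists a.
Qed.

Lemma nonempty_compacts_bounded (R : realType) (n : nat) (A : set 'rV[R]_n) :
  nonempty_compacts R n A -> ebounded A.
Proof. by move=> [_ /compact_edistanceP []]. Qed.

(** * The rigid Hausdorff distance *)

(** One of the two rigid isometries in the definition can be taken to be the
    identity, as the Hausdorff distance is invariant under a common motion. *)
Lemma rigid_hausdorff_dist_lt (R : realType) (n : nat) (e : R)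
    (A B : set 'rV[R]_n) :
  nonempty_compacts R n A -> nonempty_compacts R n B ->
  rigid_hausdorff_dist A B < e ->
  exists2 f, rigid_similitude 1 f & mutually_close e A (f @` B).
Proof.
move=> cA cB.
move=> /inf_lt [|_ [phi [psi [/rigid_isometryE rphi /rigid_isometryE rpsi ->]]]].
  exists (hausdorff_dist (id @` A) (id @` B)), id, id.
  by split=> //; apply/rigid_isometryE/rigid_similitude_id.
have cA' := nonempty_compacts_image ltr01 rphi cA.
have cB' := nonempty_compacts_image ltr01 rpsi cB.
move=> /(hausdorff_dist_lt (nonempty_compacts_bounded cA')
  (nonempty_compacts_bounded cB') (proj1 cA') (proj1 cB')).
have [g [rg phiK _]] := rigid_similitude_inv ltr01 rphi; rewrite invr1 in rg.
move=> /(mutually_close_image rg); rewrite (image_cancel _ phiK) image_comp => h.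
exists (g \o psi) => //.
by have := rigid_similitude_comp ltr01 ltr01 rg rpsi; rewrite mulr1.
Qed.

Lemma rigid_hausdorff_dist_le (R : realType) (n : nat) (e : R)
    (f : 'rV[R]_n -> 'rV[R]_n) (A B : set 'rV[R]_n) :
  nonempty_compacts R n A -> nonempty_compacts R n B ->
  rigid_similitude 1 f -> mutually_close e A (f @` B) ->
  rigid_hausdorff_dist A B <= e.
Proof.
move=> cA cB rf AfB.
have cfB := nonempty_compacts_image ltr01 rf cB.
apply: le_trans (hausdorff_dist_le (proj1 cA) (proj1 cfB) AfB).
apply: ge_inf.
  exists 0 => _ [phi [psi [/rigid_isometryE rphi /rigid_isometryE rpsi ->]]].
  have cA' := nonempty_compacts_image ltr01 rphi cA.
  have cB' := nonempty_compacts_image ltr01 rpsi cB.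
  by apply: hausdorff_dist_ge0 (proj1 cA') (proj1 cB');
    exact: nonempty_compacts_bounded.
exists id, f; split; last by rewrite image_id.
  exact/rigid_isometryE/rigid_similitude_id.
exact/rigid_isometryE.
Qed.

Lemma rigid_hausdorff_dist_ge0 (R : realType) (n : nat) (A B : set 'rV[R]_n) :
  nonempty_compacts R n A -> nonempty_compacts R n B ->
  0 <= rigid_hausdorff_dist A B.
Proof.
move=> cA cB; rewrite leNgt; apply/negP => g0.
have glt : rigid_hausdorff_dist A B < rigid_hausdorff_dist A B / 2 by lra.
have [f _] := rigid_hausdorff_dist_lt cA cB glt.
by move=> /(mutually_close_ge0 (proj1 cA)); lra.
Qed.

Lemma rigid_hausdorff_dist_sym_le (R : realType) (n : nat)
    (A B : set 'rV[R]_n) :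
  nonempty_compacts R n A -> nonempty_compacts R n B ->
  rigid_hausdorff_dist A B <= rigid_hausdorff_dist B A.
Proof.
move=> cA cB; apply/ler_addgt0Pr => e e0.
have := rigid_hausdorff_dist_lt cB cA (_ : _ < rigid_hausdorff_dist B A + e).
rewrite ltrDl => /(_ e0) [f rf /mutually_close_sym BfA].
have [g [rg fK _]] := rigid_similitude_inv ltr01 rf; rewrite invr1 in rg.
apply: (rigid_hausdorff_dist_le cA cB rg).
by have := mutually_close_image rg BfA; rewrite (image_cancel _ fK).
Qed.

Lemma rigid_hausdorff_dist_sym (R : realType) (n : nat)
    (A B : set 'rV[R]_n) :
  nonempty_compacts R n A -> nonempty_compacts R n B ->
  rigid_hausdorff_dist A B = rigid_hausdorff_dist B A.
Proof. by move=> cA cB; apply/le_anti; rewrite !rigid_hausdorff_dist_sym_le. Qed.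

Lemma rigid_hausdorff_dist_triangle (R : realType) (n : nat)
    (B A C : set 'rV[R]_n) :
  nonempty_compacts R n A -> nonempty_compacts R n B ->
  nonempty_compacts R n C ->
  rigid_hausdorff_dist A C <=
  rigid_hausdorff_dist A B + rigid_hausdorff_dist B C.
Proof.
move=> cA cB cC; apply/ler_addgt0Pr => e e0.
have e2 : 0 < e / 2 by lra.
have := rigid_hausdorff_dist_lt cA cB (_ : _ < rigid_hausdorff_dist A B + e / 2).
rewrite ltrDl => /(_ e2) [f rf AfB].
have := rigid_hausdorff_dist_lt cB cC (_ : _ < rigid_hausdorff_dist B C + e / 2).
rewrite ltrDl => /(_ e2) [g rg /(mutually_close_image rf) BgC].
have rfg := rigid_similitude_comp ltr01 ltr01 rf rg; rewrite mulr1 in rfg.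
apply: (rigid_hausdorff_dist_le cA cC rfg); rewrite image_comp in BgC.
by apply: mutually_close_le (mutually_close_trans AfB BgC); lra.
Qed.

(** Each set is at distance 0 from its moved copy, so four triangle
    inequalities suffice. *)
Lemma rigid_hausdorff_dist_image (R : realType) (n : nat)
    (f g : 'rV[R]_n -> 'rV[R]_n) (A B : set 'rV[R]_n) :
  nonempty_compacts R n A -> nonempty_compacts R n B ->
  rigid_similitude 1 f -> rigid_similitude 1 g ->
  rigid_hausdorff_dist (f @` A) (g @` B) = rigid_hausdorff_dist A B.
Proof.
move=> cA cB rf rg.
have self0 h C : rigid_similitude 1 h -> nonempty_compacts R n C ->
    rigid_hausdorff_dist (h @` C) C <= 0.
  move=> rh cC; have chC := nonempty_compacts_image ltr01 rh cC.
  apply: (rigid_hausdorff_dist_le chC cC rh).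
  by split=> x hx; exists x => //; rewrite edistancexx.
have cfA := nonempty_compacts_image ltr01 rf cA.
have cgB := nonempty_compacts_image ltr01 rg cB.
have fA0 := self0 _ _ rf cA; have gB0 := self0 _ _ rg cB.
have t1 := rigid_hausdorff_dist_triangle cfA cA cgB.
have t2 := rigid_hausdorff_dist_triangle cA cB cgB.
have t3 := rigid_hausdorff_dist_triangle cA cfA cB.
have t4 := rigid_hausdorff_dist_triangle cfA cgB cB.
rewrite (rigid_hausdorff_dist_sym cB cgB) in t2.
rewrite (rigid_hausdorff_dist_sym cA cfA) in t3.
by apply/le_anti/andP; split; lra.
Qed.

(** * Radius *)

Lemma circumradius_ge0 (R : realType) (n : nat) (A : set 'rV[R]_n) x :
  nonempty_compacts R n A ->
  has_ubound [set edistance x a | a in A] /\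
  0 <= sup [set edistance x a | a in A].
Proof.
move=> cA; have [[a Aa] _] := cA; have [M AM] := nonempty_compacts_bounded cA.
have ub : has_ubound [set edistance x a | a in A].
  exists (edistance x 0 + M) => _ [b Bb <-].
  by apply: le_trans (edistance_triangle 0 _ _) _; rewrite lerD2l AM.
split=> //; apply: le_trans (edistance_ge0 x a) _.
by apply: (ub_le_sup ub); exists a.
Qed.

Lemma radius_le (R : realType) (n : nat) (e : R) (A : set 'rV[R]_n) x :
  nonempty_compacts R n A -> (forall a, A a -> edistance x a <= e) ->
  radius A <= e.
Proof.
move=> cA xA; have [[a Aa] _] := cA.
apply: le_trans (_ : sup [set edistance x a | a in A] <= e).
  apply: ge_inf; last by exists x.
  by exists 0 => _ [y _ <-]; exact: proj2 (circumradius_ge0 y cA).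
by apply: ge_sup => [|_ [b /xA ? <-] //]; exists (edistance x a); exists a.
Qed.

(** The strict inequality provides an actual center, without minimizing the
    circumradius. *)
Lemma radius_lt (R : realType) (n : nat) (e : R) (A : set 'rV[R]_n) :
  nonempty_compacts R n A -> radius A < e ->
  exists x, forall a, A a -> edistance x a <= e.
Proof.
move=> cA /inf_lt [|_ [x _ <-] xA].
  by exists (sup [set edistance 0 a | a in A]), 0.
exists x => a Aa; apply: le_trans (ltW xA).
by apply: (ub_le_sup (proj1 (circumradius_ge0 x cA))); exists a.
Qed.

Lemma radius_ge0 (R : realType) (n : nat) (A : set 'rV[R]_n) :
  nonempty_compacts R n A -> 0 <= radius A.
Proof.
move=> cA; apply: lb_le_inf.
  by exists (sup [set edistance 0 a | a in A]), 0.
by move=> _ [y _ <-]; exact: proj2 (circumradius_ge0 y cA).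
Qed.

Lemma radius_mutually_close (R : realType) (n : nat) (e : R)
    (A B : set 'rV[R]_n) :
  nonempty_compacts R n A -> nonempty_compacts R n B ->
  mutually_close e A B -> radius A <= radius B + e.
Proof.
move=> cA cB [AB _]; apply/ler_addgt0Pr => d d0.
have := radius_lt cB (_ : _ < radius B + d); rewrite ltrDl => /(_ d0) [x xB].
apply: (radius_le (x := x)) => // a /AB [b /xB xb ab].
apply: le_trans (edistance_triangle b _ _) _.
by rewrite (edistanceC b); lra.
Qed.

Lemma radius_image_le (R : realType) (n : nat) (r : R)
    (f : 'rV[R]_n -> 'rV[R]_n) (A : set 'rV[R]_n) : 0 < r ->
  rigid_similitude r f -> nonempty_compacts R n A ->
  radius (f @` A) <= r * radius A.
Proof.
move=> r0 rf cA; rewrite -ler_pdivrMl//; apply/ler_addgt0Pr => d d0.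
have := radius_lt cA (_ : _ < radius A + d); rewrite ltrDl => /(_ d0) [x xA].
rewrite ler_pdivrMl//.
apply: (radius_le (x := f x)) (nonempty_compacts_image r0 rf cA) _.
move=> _ [a /xA xa <-].
by rewrite (rigid_similitude_edistance _ _ r0 rf) ler_pM2l.
Qed.

Lemma radius_image (R : realType) (n : nat) (r : R)
    (f : 'rV[R]_n -> 'rV[R]_n) (A : set 'rV[R]_n) : 0 < r ->
  rigid_similitude r f -> nonempty_compacts R n A ->
  radius (f @` A) = r * radius A.
Proof.
move=> r0 rf cA; apply/le_anti; rewrite radius_image_le//=.
have ri0 : 0 < r^-1 by rewrite invr_gt0.
have [g [rg fK _]] := rigid_similitude_inv r0 rf.
have := radius_image_le ri0 rg (nonempty_compacts_image r0 rf cA).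
by rewrite (image_cancel _ fK) ler_pdivlMl.
Qed.

(** A center for a moved copy of [B] serves for [A] too, at the cost of the
    distance: the radius is 1-Lipschitz. *)
Lemma radius_le_rigid_hausdorff_dist (R : realType) (n : nat)
    (A B : set 'rV[R]_n) :
  nonempty_compacts R n A -> nonempty_compacts R n B ->
  radius A <= radius B + rigid_hausdorff_dist A B.
Proof.
move=> cA cB; apply/ler_addgt0Pr => d d0.
have := rigid_hausdorff_dist_lt cA cB (_ : _ < rigid_hausdorff_dist A B + d).
rewrite ltrDl => /(_ d0) [f rf AfB].
have := radius_mutually_close cA (nonempty_compacts_image ltr01 rf cB) AfB.
by rewrite (radius_image ltr01 rf cB) mul1r addrA.
Qed.

Lemma radius_set1 (R : realType) (n : nat) (x : 'rV[R]_n) :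
  nonempty_compacts R n [set x] -> radius [set x] = 0.
Proof.
move=> cx; apply/le_anti; rewrite radius_ge0// andbT.
by apply: (radius_le (x := x)) => // _ ->; rewrite edistancexx.
Qed.

(** Two points of [A] lie in a common ball of arbitrarily small radius. *)
Lemma radius_eq0 (R : realType) (n : nat) (A : set 'rV[R]_n) :
  nonempty_compacts R n A -> radius A = 0 -> exists x, A = [set x].
Proof.
move=> cA A0; have [[a Aa] _] := cA; exists a; apply/seteqP; split; last first.
  by move=> _ ->.
move=> b Ab /=; apply: edistance_eq0; apply/ler_addgt0Pr => d d0.
have d2 : radius A < d / 2 by rewrite A0; lra.
have [x xA] := radius_lt cA d2; rewrite add0r.
apply: le_trans (edistance_triangle x b a) _.
by rewrite (edistanceC b); have := xA a Aa; have := xA b Ab; lra.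
Qed.

(** * Normalization *)

(** The factor is 1 for singletons, whose radius is 0. *)
Lemma normalize_set_image (R : realType) (n : nat) (A : set 'rV[R]_n) :
  nonempty_compacts R n A ->
  exists r f, [/\ 0 < r, rigid_similitude r f & normalize_set A = f @` A].
Proof.
move=> cA; rewrite /normalize_set; case: asboolP => [_|nsA].
  exists 1, id; split=> //; first exact: rigid_similitude_id.
  by rewrite image_id.
have r0 : 0 < (radius A)^-1.
  rewrite invr_gt0 lt_def radius_ge0// andbT; apply/eqP => /(radius_eq0 cA).
  exact: nsA.
exists (radius A)^-1, (fun x => (radius A)^-1 *: x); split=> //.
exact: rigid_similitude_scale.
Qed.

Lemma normalize_set_compact (R : realType) (n : nat) (A : set 'rV[R]_n) :
  nonempty_compacts R n A -> nonempty_compacts R n (normalize_set A).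
Proof.
move=> cA; have [r [f [r0 rf ->]]] := normalize_set_image cA.
exact: nonempty_compacts_image r0 rf cA.
Qed.

Lemma radius_normalize_set (R : realType) (n : nat) (A : set 'rV[R]_n) :
  nonempty_compacts R n A ->
  radius (normalize_set A) = 0 \/ radius (normalize_set A) = 1.
Proof.
move=> cA; rewrite /normalize_set; case: asboolP => [[x A1]|nsA].
  by left; rewrite A1; apply: radius_set1; rewrite -A1.
have rn0 : radius A != 0 by apply/eqP => /(radius_eq0 cA); exact: nsA.
have r0 : 0 < (radius A)^-1 by rewrite invr_gt0 lt_def rn0 radius_ge0.
right; rewrite /scale_set (radius_image r0 (rigid_similitude_scale _ r0) cA).
by rewrite mulVf.
Qed.

Lemma normalize_set_id (R : realType) (n : nat) (A : set 'rV[R]_n) :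
  nonempty_compacts R n A -> radius A = 0 \/ radius A = 1 ->
  normalize_set A = A.
Proof.
move=> cA A01; rewrite /normalize_set; case: asboolP => // nsA.
case: A01 => [/(radius_eq0 cA) //|->].
rewrite invr1 /scale_set; under eq_fun => x do rewrite scale1r.
exact: image_id.
Qed.

Lemma rigidly_similar_refl (R : realType) (n : nat) (A : set 'rV[R]_n) :
  rigidly_similar A A.
Proof.
by exists 1, id; split=> //; [exact: rigid_similitude_id|rewrite image_id].
Qed.

Lemma rigidly_similar_sym (R : realType) (n : nat) (A B : set 'rV[R]_n) :
  rigidly_similar A B -> rigidly_similar B A.
Proof.
move=> [r [f [r0 rf ->]]]; have [g [rg fK _]] := rigid_similitude_inv r0 rf.
by exists r^-1, g; rewrite invr_gt0 (image_cancel _ fK).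
Qed.

Lemma rigidly_similar_trans (R : realType) (n : nat) (B A C : set 'rV[R]_n) :
  rigidly_similar A B -> rigidly_similar B C -> rigidly_similar A C.
Proof.
move=> [r [f [r0 rf ->]]] [s [g [s0 rg ->]]]; exists (s * r), (g \o f).
by rewrite mulr_gt0// image_comp; split=> //; exact: rigid_similitude_comp.
Qed.

Lemma similarity_classP (R : realType) (n : nat) (A B : set 'rV[R]_n) :
  similarity_class A = similarity_class B <-> rigidly_similar A B.
Proof.
split=> [AB|AB].
  have : similarity_class B B by exact: rigidly_similar_refl.
  by rewrite -AB.
by apply/seteqP; split=> C /=; apply: rigidly_similar_trans => //;
  exact: rigidly_similar_sym.
Qed.

Lemma rigidly_similar_normalize (R : realType) (n : nat) (A : set 'rV[R]_n) :
  nonempty_compacts R n A -> rigidly_similar A (normalize_set A).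
Proof.
by move=> cA; have [r [f [r0 rf ->]]] := normalize_set_image cA; exists r, f.
Qed.

(** A similitude between two normalized sets has factor 1 when the radii are 1,
    and a similitude between two singletons can be replaced by a translation. *)
Lemma rigidly_similar_normalizeP (R : realType) (n : nat)
    (A B : set 'rV[R]_n) :
  nonempty_compacts R n A -> nonempty_compacts R n B ->
  rigidly_similar A B <->
  exists2 f, rigid_similitude 1 f & normalize_set B = f @` normalize_set A.
Proof.
move=> cA cB; split=> [AB|[f rf BfA]]; last first.
  apply: rigidly_similar_trans (rigidly_similar_normalize cA) _.
  apply: rigidly_similar_trans (rigidly_similar_sym (rigidly_similar_normalize cB)).
  by exists 1, f.
have := rigidly_similar_sym (rigidly_similar_normalize cA).
move=> /rigidly_similar_trans /(_ AB).
move=> /rigidly_similar_trans /(_ (rigidly_similar_normalize cB)).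
have cNA := normalize_set_compact cA; have cNB := normalize_set_compact cB.
move=> [r [f [r0 rf BfA]]]; have := radius_image r0 rf cNA; rewrite -BfA.
have [A0|A1] := radius_normalize_set cA; last first.
  have [->|->] := radius_normalize_set cB; rewrite A1 mulr1 => r1.
    by rewrite -r1 ltxx in r0.
  by exists f => //; rewrite r1.
rewrite A0 mulr0 => B0; have [x Ax] := radius_eq0 cNA A0.
have [y By] := radius_eq0 cNB B0; exists (fun z => z + (y - x)).
  exact: rigid_similitude_translation.
by rewrite Ax By image_set1 addrC subrK.
Qed.

Lemma shape_diff_similar (R : realType) (n : nat) (A B C D : set 'rV[R]_n) :
  nonempty_compacts R n A -> nonempty_compacts R n B ->
  nonempty_compacts R n C -> nonempty_compacts R n D ->
  rigidly_similar A C -> rigidly_similar B D -> shape_diff A B = shape_diff C D.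
Proof.
move=> cA cB cC cD /(rigidly_similar_normalizeP cA cC) [f rf Cf].
move=> /(rigidly_similar_normalizeP cB cD) [g rg Dg].
by rewrite /shape_diff Cf Dg rigid_hausdorff_dist_image//;
  exact: normalize_set_compact.
Qed.

(** * Limits of rigid isometries *)

Lemma cvg_sum_real (R : realType) (T : Type) (F : set_system T)
    (FF : Filter F) (I : Type) (r : seq I) (f : I -> T -> R) (l : I -> R) :
  (forall i, f i @ F --> l i) ->
  (fun t => \sum_(i <- r) f i t) @ F --> \sum_(i <- r) l i.
Proof. by move=> fl; apply: (cvg_big add_continuous) => // i _; exact: fl. Qed.

Lemma cvg_prod_real (R : realType) (T : Type) (F : set_system T)
    (FF : Filter F) (I : Type) (r : seq I) (f : I -> T -> R) (l : I -> R) :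
  (forall i, f i @ F --> l i) ->
  (fun t => \prod_(i <- r) f i t) @ F --> \prod_(i <- r) l i.
Proof. by move=> fl; apply: (cvg_big mul_continuous) => // i _; exact: fl. Qed.

Lemma cvg_det (R : realType) (n : nat) (T : Type) (F : set_system T)
    (FF : Filter F) (P : T -> 'M[R]_n) (Q : 'M[R]_n) :
  (forall i j, (fun t => P t i j) @ F --> Q i j) ->
  (fun t => \det (P t)) @ F --> \det Q.
Proof.
move=> PQ; apply: cvg_sum_real => s; apply: cvgM; first exact: cvg_cst.
by apply: cvg_prod_real => i; exact: PQ.
Qed.

Lemma cvg_mulmx (R : realType) (m n p : nat) (T : Type) (F : set_system T)
    (FF : Filter F) (P : T -> 'M[R]_(m, n)) (P' : T -> 'M[R]_(n, p))
    (Q : 'M[R]_(m, n)) (Q' : 'M[R]_(n, p)) :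
  (forall i j, (fun t => P t i j) @ F --> Q i j) ->
  (forall i j, (fun t => P' t i j) @ F --> Q' i j) ->
  forall i j, (fun t => (P t *m P' t) i j) @ F --> (Q *m Q') i j.
Proof.
move=> PQ PQ' i j; rewrite mxE.
rewrite (_ : (fun t => _) = (fun t => \sum_k P t i k * P' t k j)); last first.
  by apply/funext => t; rewrite mxE.
by apply: cvg_sum_real => k; exact: cvgM.
Qed.

(** The rows of an orthogonal matrix are unit vectors. *)
Lemma rotation_entry_le1 (R : realType) (n : nat) (P : 'M[R]_n) i j :
  P *m P^T = 1%:M -> `|P i j| <= 1.
Proof.
move=> PP; rewrite -[leRHS]sqrtr1 -sqrtr_sqr ler_sqrt ?ltr01//.
have -> : (1 : R) = \sum_k (P i k) ^+ 2.
  have := congr1 (fun Q : 'M[R]_n => Q i i) PP; rewrite !mxE eqxx mulr1n => <-.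
  by apply: eq_bigr => k _; rewrite mxE expr2.
by rewrite (bigD1 j)//= lerDl; apply: sumr_ge0 => k _; exact: sqr_ge0.
Qed.

Lemma ultra_bounded_matrix_cvg (R : realType) (m n : nat) (T : Type)
    (F : set_system T) (FU : UltraFilter F) (P : T -> 'M[R]_(m, n)) (M : R) :
  (forall t i j, `|P t i j| <= M) ->
  exists Q : 'M[R]_(m, n), forall i j, (fun t => P t i j) @ F --> Q i j.
Proof.
move=> PM.
have [q qP] := choice (fun ij : 'I_m * 'I_n =>
  ultra_bounded_cvg FU (fun t => PM t ij.1 ij.2)).
by exists (\matrix_(i, j) q (i, j)) => i j; rewrite mxE; exact: (qP (i, j)).
Qed.

(** Compactness of the rotation group, together with boundedness of the
    translation parts; a subsequence is replaced by an ultrafilter. *)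
Lemma ultra_rigid_isometry_limit (R : realType) (n : nat) (T : Type)
    (F : set_system T) (FU : UltraFilter F) (f : T -> 'rV[R]_n -> 'rV[R]_n)
    (M : R) :
  (forall t, rigid_similitude 1 (f t)) ->
  (forall t, edistance 0 (f t 0) <= M) ->
  exists2 g, rigid_similitude 1 g &
    forall x e, 0 < e -> \forall t \near F, edistance (f t x) (g x) <= e.
Proof.
move=> rf fM; have PF := @ultra_proper _ _ FU.
have [P fP] := choice (fun t => proj1 (rigid_similitudeP _ ltr01) (rf t)).
have [c fE] := choice fP => {fP rf}.
have [Q PQ] : exists Q : 'M[R]_n, forall i j, (fun t => P t i j) @ F --> Q i j.
  apply: (ultra_bounded_matrix_cvg FU (M := 1)) => t i j.
  by have [PP _ _] := fE t; exact: rotation_entry_le1.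
have [d cd] : exists d : 'rV[R]_n, forall i j, (fun t => c t i j) @ F --> d i j.
  apply: (ultra_bounded_matrix_cvg FU (M := M)) => t i j.
  rewrite ord1; have := coord_le_edistance 0 (c t) j.
  rewrite mxE sub0r normrN => /le_trans; apply.
  by have := fM t; have [_ _ ->] := fE t; rewrite mul0mx scaler0 add0r.
exists (fun x => 1 *: (x *m Q) + d).
  apply/(rigid_similitudeP _ ltr01); exists Q, d; split=> //.
    apply/matrixP => i j.
    have QQ : (fun t => (P t *m (P t)^T) i j) @ F --> (Q *m Q^T) i j.
      apply: cvg_mulmx => [k l|k l]; first exact: PQ.
      rewrite mxE (_ : (fun t => _) = (fun t => P t l k)); first exact: PQ.
      by apply/funext => t; rewrite mxE.
    apply: (cvg_unique _ QQ) => //.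
    have -> : (fun t => (P t *m (P t)^T) i j) = fun=> (1%:M : 'M[R]_n) i j.
      by apply/funext => t; have [-> _ _] := fE t.
    exact: cvg_cst.
  have dQ : (fun t => \det (P t)) @ F --> \det Q by exact: cvg_det.
  apply: (cvg_unique _ dQ) => //.
  have -> : (fun t => \det (P t)) = fun=> 1.
    by apply/funext => t; have [_ -> _] := fE t.
  exact: cvg_cst.
move=> x e e0; apply: near_edistance_le => // i.
have -> : (fun t => f t x 0 i) = (fun t => (x *m P t) 0 i + c t 0 i).
  by apply/funext => t; have [_ _ ->] := fE t; rewrite scale1r mxE.
rewrite scale1r mxE; apply: cvgD; last exact: cd.
by apply: cvg_mulmx => // k l; exact: cvg_cst.
Qed.

Lemma exists_free_ultrafilter :
  exists F : set_system nat,
    UltraFilter F /\ forall N, \forall k \near F, (N <= k)%N.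
Proof.
have [F [FU oF]] := ultraFilterLemma (@eventually_filter).
by exists F; split=> // N; apply: oF; exact: nbhs_infty_ge.
Qed.

Lemma exists_invS_le (R : realType) (e : R) : 0 < e ->
  exists N : nat, forall k, (N <= k)%N -> k.+1%:R^-1 <= e.
Proof.
move=> e0; exists (Num.bound e^-1) => k Nk.
rewrite -[leRHS]invrK lef_pV2 ?posrE ?invr_gt0 ?ltr0n//.
have := archi_boundP (ltW (_ : 0 < e^-1)); rewrite invr_gt0 => /(_ e0) /ltW.
move=> /le_trans; apply; rewrite ler_nat; exact: leqW.
Qed.

(** The limit motion [g] maps [B] into [A] because [A] is closed; conversely
    a point of [A] is the image of its inverse image by [g], which lies in [B]
    because [B] is closed. *)
Lemma rigid_hausdorff_dist_eq0 (R : realType) (n : nat) (A B : set 'rV[R]_n) :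
  nonempty_compacts R n A -> nonempty_compacts R n B ->
  rigid_hausdorff_dist A B = 0 ->
  exists2 f, rigid_similitude 1 f & A = f @` B.
Proof.
move=> cA cB AB0.
have /choice [f /all_and2 [rf AfB]] : forall k : nat, exists f,
    rigid_similitude 1 f /\ mutually_close (k.+1%:R^-1) A (f @` B).
  move=> k; have : rigid_hausdorff_dist A B < k.+1%:R^-1.
    by rewrite AB0 invr_gt0 ltr0n.
  by move=> /(rigid_hausdorff_dist_lt cA cB) [f ? ?]; exists f.
have fd k x y : edistance (f k x) (f k y) = edistance x y.
  by rewrite (rigid_similitude_edistance _ _ ltr01 (rf k)) mul1r.
have [[_ _] /compact_edistanceP [[M AM] Acl]] := cA.
have [[b0 Bb0] /compact_edistanceP [_ Bcl]] := cB.
(* the motions nearly map the point [b0] into the bounded set [A] *)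
have fM k : edistance 0 (f k 0) <= M + (1 + edistance b0 0).
  have [a Aa ab] : exists2 a, A a & edistance a (f k b0) <= k.+1%:R^-1.
    by apply: (proj2 (AfB k)); exists b0.
  apply: le_trans (edistance_triangle a _ _) (lerD (AM a Aa) _).
  apply: le_trans (edistance_triangle (f k b0) _ _) _.
  rewrite fd lerD2r; apply: le_trans ab _.
  by rewrite invf_le1 ?ltr0n// ler1n.
have [F [FU Foo]] := exists_free_ultrafilter.
have PF := @ultra_proper _ _ FU.
have [g rg fg] := ultra_rigid_isometry_limit FU rf fM.
have pick x e : 0 < e ->
    exists2 k, edistance (f k x) (g x) <= e & k.+1%:R^-1 <= e.
  move=> e0; have [N Ne] := exists_invS_le e0.
  have [k [kx Nk]] := filter_ex (filterI (fg x e e0) (Foo N)).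
  by exists k => //; exact: Ne.
exists g => //; apply/seteqP; split=> [a Aa|_ [b Bb <-]].
  (* [f k] nearly maps both [b] and [g' a] to [a], and it preserves distances *)
  have [g' [_ gK g'K]] := rigid_similitude_inv ltr01 rg.
  exists (g' a) => //; apply: Bcl => e e0; have e2 : 0 < e / 2 by lra.
  have [k kx ke] := pick (g' a) _ e2; rewrite g'K in kx.
  have [_ [b Bb <-] ab] := proj1 (AfB k) a Aa; exists b => //.
  rewrite -(fd k); apply: le_trans (edistance_triangle a _ _) _.
  by have := le_trans ab ke; lra.
apply: Acl => e e0; have e2 : 0 < e / 2 by lra.
have [k kx ke] := pick b _ e2.
have [a Aa ab] : exists2 a, A a & edistance a (f k b) <= k.+1%:R^-1.
  by apply: (proj2 (AfB k)); exists b.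
exists a => //; apply: le_trans (edistance_triangle (f k b) _ _) _.
by rewrite edistanceC (edistanceC _ a); have := le_trans ab ke; lra.
Qed.

(** * Completeness of the Hausdorff distance *)

(** The partial sum [2 (2^-i - 2^-k)] of the geometric series makes the
    induction work. *)
Lemma mutually_close_geometric (R : realType) (n : nat)
    (B : nat -> set 'rV[R]_n) :
  (forall j, mutually_close (2^-1 ^+ j) (B j) (B j.+1)) ->
  forall i k, (i <= k)%N -> mutually_close (2 * 2^-1 ^+ i) (B i) (B k).
Proof.
move=> BB i k ik; rewrite -(subnKC ik); set m := (k - i)%N.
suff : mutually_close (2 * (2^-1 ^+ i - 2^-1 ^+ (i + m))) (B i) (B (i + m)%N).
  apply: mutually_close_le.
  have : 0 <= 2^-1 ^+ (i + m) :> R by rewrite exprn_ge0 ?invr_ge0 ?ler0n.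
  lra.
elim: m => [|m ih].
  rewrite addn0 subrr mulr0.
  by split=> x Bx; exists x => //; rewrite edistancexx.
rewrite addnS; apply: mutually_close_le (mutually_close_trans ih (BB _)).
by rewrite exprS; lra.
Qed.

(** The limit consists of the points whose distance to each term is within the
    tail of the geometric series; the slack [e] makes it visibly closed. *)
Lemma geometric_hausdorff_limit (R : realType) (n : nat)
    (B : nat -> set 'rV[R]_n) :
  (forall j, nonempty_compacts R n (B j)) ->
  (forall j, mutually_close (2^-1 ^+ j) (B j) (B j.+1)) ->
  exists2 L, nonempty_compacts R n L &
    forall j, mutually_close (3 * 2^-1 ^+ j) (B j) L.
Proof.
move=> cB /mutually_close_geometric BB.
have h0 j : 0 < 2^-1 ^+ j :> R by rewrite exprn_gt0 ?invr_gt0 ?ltr0n.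
pose L := [set x : 'rV[R]_n | forall j (e : R), 0 < e ->
  exists2 b, B j b & edistance x b <= 2 * 2^-1 ^+ j + e].
have [F [FU Foo]] := exists_free_ultrafilter.
have PF := @ultra_proper _ _ FU.
have BL j b : B j b -> exists2 x, L x & edistance b x <= 2 * 2^-1 ^+ j.
  move=> Bb.
  (* any limit point of such a sequence will do *)
  have /choice [y /all_and2 [By by_]] : forall k, exists y,
      B (j + k)%N y /\ edistance b y <= 2 * 2^-1 ^+ j.
    by move=> k; have [y ? ?] := proj1 (BB j _ (leq_addr k j)) b Bb; exists y.
  have [x yx] : exists x : 'rV[R]_n,
      forall i i', (fun k => y k i i') @ F --> x i i'.
    apply: (ultra_bounded_matrix_cvg FU
      (M := edistance 0 b + 2 * 2^-1 ^+ j)) => k i i'; rewrite ord1.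
    have := coord_le_edistance 0 (y k) i'; rewrite mxE sub0r normrN.
    move=> /le_trans; apply; apply: le_trans (edistance_triangle b _ _) _.
    by rewrite lerD2l.
  have yxe (e : R) : 0 < e -> \forall k \near F, edistance (y k) x <= e.
    by move=> e0; apply: near_edistance_le.
  exists x; last first.
    apply/ler_addgt0Pr => e e0; have [k ke] := filter_ex (yxe e e0).
    by apply: le_trans (edistance_triangle (y k) _ _) _; exact: lerD.
  move=> i e e0; have [k [ke ik]] := filter_ex (filterI (yxe e e0) (Foo i)).
  have ijk : (i <= j + k)%N by exact: leq_trans ik (leq_addl _ _).
  have [b' Bb' b'y] := proj2 (BB i _ ijk) _ (By k); exists b' => //.
  apply: le_trans (edistance_triangle (y k) _ _) _.
  by rewrite edistanceC (edistanceC _ b') addrC lerD.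
exists L; last first.
  move=> j; split=> [b /BL [x Lx bx]|x Lx].
    by exists x => //; apply: le_trans bx _; have := h0 j; lra.
  have [b Bb xb] := Lx j _ (h0 j); exists b => //; rewrite edistanceC.
  by apply: le_trans xb _; lra.
have [[b0 Bb0] _] := cB 0%N.
split; first by have [x Lx _] := BL 0%N b0 Bb0; exists x.
apply/compact_edistanceP; split.
  have [M BM] := nonempty_compacts_bounded (cB 0%N).
  exists (M + (2 * 2^-1 ^+ 0 + 1)) => x /(_ 0%N 1 ltr01) [b /BM bM xb].
  apply: le_trans (edistance_triangle b _ _) _.
  by rewrite (edistanceC b); exact: lerD.
move=> x xL j e e0; have e2 : 0 < e / 2 by lra.
have [z /(_ j _ e2) [b Bb zb] xz] := xL _ e2; exists b => //.
by apply: le_trans (edistance_triangle z _ _) _; lra.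
Qed.

(** Each term is moved to be close to its already moved predecessor, which
    reduces the quotient distance to the Hausdorff distance. *)
Lemma geometric_rigid_hausdorff_limit (R : realType) (n : nat)
    (A : nat -> set 'rV[R]_n) :
  (forall j, nonempty_compacts R n (A j)) ->
  (forall j, rigid_hausdorff_dist (A j) (A j.+1) < 2^-1 ^+ j) ->
  exists2 L, nonempty_compacts R n L &
    forall j, rigid_hausdorff_dist (A j) L <= 3 * 2^-1 ^+ j.
Proof.
move=> cA AA.
have /choice [f /all_and2 [rf Af]] : forall j, exists f,
    rigid_similitude 1 f /\ mutually_close (2^-1 ^+ j) (A j) (f @` A j.+1).
  move=> j.
  by have [f ? ?] := rigid_hausdorff_dist_lt (cA j) (cA j.+1) (AA j); exists f.
(* the motion applied to the j-th set, composed of the preceding ones *)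
pose psi := fix psi j := if j is i.+1 then psi i \o f i else id.
have rpsi j : rigid_similitude 1 (psi j).
  elim: j => [|j ih]; first exact: rigid_similitude_id.
  by have := rigid_similitude_comp ltr01 ltr01 ih (rf j); rewrite mulr1.
have [|j|L cL BL] := @geometric_hausdorff_limit _ _ (fun j => psi j @` A j).
- by move=> j; exact: nonempty_compacts_image ltr01 (rpsi j) (cA j).
- by have := mutually_close_image (rpsi j) (Af j); rewrite image_comp.
exists L => // j; rewrite rigid_hausdorff_dist_sym//.
apply: (rigid_hausdorff_dist_le cL (cA j) (rpsi j)).
exact: mutually_close_sym (BL j).
Qed.

Lemma exists_geometric_lt (R : realType) (c e : R) : 0 < e ->
  exists j : nat, c * 2^-1 ^+ j < e.
Proof.
move=> e0; exists (Num.bound (c / e)).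
rewrite exprVn ltr_pdivrMr ?exprn_gt0 ?ltr0n// -ltr_pdivrMl// mulrC.
exact: upper_nthrootP.
Qed.

Lemma rigid_hausdorff_dist_complete (R : realType) (n : nat)
    (A : nat -> set 'rV[R]_n) :
  (forall k, nonempty_compacts R n (A k)) ->
  (forall e : R, 0 < e -> exists N : nat, forall i j : nat,
     (N <= i)%N -> (N <= j)%N -> rigid_hausdorff_dist (A i) (A j) < e) ->
  exists2 L, nonempty_compacts R n L & forall e : R, 0 < e ->
    exists N : nat, forall i, (N <= i)%N -> rigid_hausdorff_dist (A i) L < e.
Proof.
move=> cA Acauchy.
have h0 j : 0 < 2^-1 ^+ j :> R by rewrite exprn_gt0 ?invr_gt0 ?ltr0n.
have /choice [N NP] := fun j => Acauchy _ (h0 j).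
(* thresholds made nondecreasing, so that consecutive ones are both large *)
pose K j := (\max_(i < j.+1) N i)%N.
have NK j : (N j <= K j)%N by exact: (leq_bigmax (ord_max : 'I_j.+1)).
have KS j : (K j <= K j.+1)%N by rewrite /K [leqRHS]big_ord_recr leq_maxl.
have [j|j|L cL AL] := @geometric_rigid_hausdorff_limit _ _ (A \o K).
- exact: cA.
- by apply: NP => //; exact: leq_trans (KS j).
exists L => // e e0; have [j je] := exists_geometric_lt 4 e0.
exists (N j) => i Ni; apply: le_lt_trans je.
apply: le_trans (rigid_hausdorff_dist_triangle (cA i) (cA (K j)) cL) _.
by have := NP j i (K j) Ni (NK j); have := AL j => /=; lra.
Qed.

(** * The metric on shapes *)

Lemma class_reprP (R : realType) (n : nat) (X : set (set 'rV[R]_n)) :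
  compact_shapes R n X ->
  nonempty_compacts R n (class_repr X) /\ similarity_class (class_repr X) = X.
Proof.
by move=> [C cC CX]; apply: (@xgetPex _ set0
  [set C | nonempty_compacts R n C /\ similarity_class C = X]); exists C.
Qed.

Lemma class_shape_diff_represents (R : realType) (n : nat) :
  represents_shape_diff (@class_shape_diff R n).
Proof.
move=> A B cA cB.
have [|cA' /similarity_classP A'A] := @class_reprP R n (similarity_class A).
  by exists A.
have [|cB' /similarity_classP B'B] := @class_reprP R n (similarity_class B).
  by exists B.
exact: shape_diff_similar.
Qed.

(** A vanishing distance between the normalized sets gives a congruence
    between them. *)
Lemma shape_diff_eq0 (R : realType) (n : nat) (A B : set 'rV[R]_n) :
  nonempty_compacts R n A -> nonempty_compacts R n B ->
  shape_diff A B = 0 <-> rigidly_similar A B.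
Proof.
move=> cA cB; have cNA := normalize_set_compact cA.
have cNB := normalize_set_compact cB; split=> [AB0|AB].
  apply/rigidly_similar_sym/(rigidly_similar_normalizeP cB cA).
  exact: rigid_hausdorff_dist_eq0.
have /(rigidly_similar_normalizeP cB cA) [f rf NBE] := rigidly_similar_sym AB.
apply/le_anti; rewrite rigid_hausdorff_dist_ge0// andbT.
apply: (rigid_hausdorff_dist_le cNA cNB rf); rewrite -NBE.
by split=> x NAx; exists x => //; rewrite edistancexx.
Qed.

Lemma class_shape_diff_metric (R : realType) (n : nat) :
  is_metric_on (compact_shapes R n) (@class_shape_diff R n).
Proof.
split.
- move=> X Y /class_reprP [cX _] /class_reprP [cY _].
  by apply: rigid_hausdorff_dist_ge0; exact: normalize_set_compact.
- move=> X Y /class_reprP [cX XE] /class_reprP [cY YE].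
  by rewrite (shape_diff_eq0 cX cY) -similarity_classP XE YE.
- move=> X Y /class_reprP [cX _] /class_reprP [cY _].
  by apply: rigid_hausdorff_dist_sym; exact: normalize_set_compact.
move=> X Y Z /class_reprP [cX _] /class_reprP [cY _] /class_reprP [cZ _].
by apply: rigid_hausdorff_dist_triangle; exact: normalize_set_compact.
Qed.

(** A limit of sets of radius 0 or 1 has radius 0 or 1, because the radius is
    1-Lipschitz; hence such a limit is its own normalization. *)
Lemma class_shape_diff_complete (R : realType) (n : nat) :
  is_complete_on (compact_shapes R n) (@class_shape_diff R n).
Proof.
move=> u uM ucauchy.
have cu k : nonempty_compacts R n (class_repr (u k)).
  by have [] := class_reprP (uM k).
pose A k := normalize_set (class_repr (u k)).
have cA k : nonempty_compacts R n (A k) by exact: normalize_set_compact.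
have [L cL AL] := rigid_hausdorff_dist_complete cA ucauchy.
have L01 : radius L = 0 \/ radius L = 1.
  have [|rn0] := eqVneq (radius L) 0; first by left.
  have [|rn1] := eqVneq (radius L) 1; first by right.
  (* no closer than this to either 0 or 1 *)
  pose e := Num.min (radius L) `|radius L - 1|.
  have e0 : 0 < e.
    by rewrite lt_min lt_def rn0 radius_ge0// normr_gt0 subr_eq0.
  have [N NP] := AL _ e0; have := NP N (leqnn N); rewrite lt_min => /andP[].
  have := radius_le_rigid_hausdorff_dist (cA N) cL.
  have := radius_le_rigid_hausdorff_dist cL (cA N).
  rewrite (rigid_hausdorff_dist_sym cL (cA N)).
  have [->|->] := radius_normalize_set (cu N); first lra.
  by case: (ger0P (radius L - 1)) => _; lra.
exists (similarity_class L); first by exists L.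
move=> e /AL [N NP]; exists N => i /NP.
have [_ <-] := class_reprP (uM i).
rewrite class_shape_diff_represents// /shape_diff.
by rewrite (normalize_set_id cL L01).
Qed.

Theorem theorem2p9 (R : realType) (n : nat) :
  [/\ represents_shape_diff (@class_shape_diff R n),
      is_metric_on (compact_shapes R n) (@class_shape_diff R n)
    & is_complete_on (compact_shapes R n) (@class_shape_diff R n)].
Proof.
split.
- exact: class_shape_diff_represents.
- exact: class_shape_diff_metric.
exact: class_shape_diff_complete.
Qed.
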